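(* Let $0<q<1$ and let $f(t)$, $t>0$, be a $q$-density of a random variable possessing finite $q$-moments of all orders, such that for some constant $C>0$, $f(q^{-j})\geqslant C\,q^{j(j+1)/2}$ for all integers $j\geqslant 0$. Let $\tilde h(t)$, $t\in(0,\infty)$, be a function such that $$\tilde h(q^{-j})=\begin{cases}(-1)^j\dfrac{q^{j(j+1)/2}}{(q;q)_j\, f(q^{-j})}, & j=0,1,2,\ldots\\[2mm] 0, & j=-1,-2,\ldots\end{cases}$$ and let $M_{\tilde h}=\sup_{j\in\mathbb{Z}}|\tilde h(q^{j})|$. Then $h(t)=\tilde h(t)/M_{\tilde h}$ is a $q$-perturbation for $f$, and the set $$\mathbf{S}=\{g:\ g\text{ is a } q\text{-density and } g\sim(1+\varepsilon h)f,\ \varepsilon\in[-1,1]\}$$ is a $q$-Stieltjes class for $f$.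
   Context: Throughout $0<q<1$. The $q$-shifted factorial is $(a;q)_0=1$, $(a;q)_j=\prod_{s=0}^{j-1}(1-aq^s)$. $q$-integrals (Jackson): $\int_0^{x} f(t)\,d_qt=x(1-q)\sum_{j=0}^\infty f(xq^j)q^j$ for $x>0$, and $\int_0^{\infty} f(t)\,d_qt=(1-q)\sum_{j=-\infty}^\infty f(q^j)q^j$. A function $f(t)$, $t>0$, is a $q$-density of a random variable $X$ if the distribution function $F_X$ of $X$ satisfies $F_X(x)=\int_0^x f(t)\,d_qt$ for all $x>0$; a function is called a $q$-density if it is a $q$-density of some random variable. The $k$-th order $q$-moment of $X$ is $m_q(k;X)=\int_0^\infty t^k f(t)\,d_qt$, $k\in\mathbb{N}_0=\{0,1,2,\dots\}$. Two functions $f,g$ on $(0,\infty)$ are equivalent, $f\sim g$, if $f(q^j)=g(q^j)$ for all $j\in\mathbb{Z}$. A function $h(t)$, $t>0$, is a $q$-perturbation for a $q$-density $f$ if $\sup_{j\in\mathbb{Z}}|h(q^j)|=1$ and $\int_0^\infty t^k f(t)h(t)\,d_qt=0$ for all $k\in\mathbb{N}_0$. If $f$ is a $q$-density and $h$ is a $q$-perturbation for $f$, the set $\{g:\ g\text{ is a } q\text{-density and } g\sim(1+\varepsilon h)f \text{ for some } \varepsilon\in[-1,1]\}$ is called a $q$-Stieltjes class for $f$ (generated by $h$). *)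

(* Defs.v *)
From HB Require Import structures.
From mathcomp Require Export all_boot all_order all_algebra.
From mathcomp Require Export all_classical all_reals all_analysis.

Set Implicit Arguments.
Unset Strict Implicit.
Unset Printing Implicit Defensive.

Import Order.TTheory GRing.Theory Num.Theory.
Import numFieldTopology.Exports numFieldNormedType.Exports.

Local Open Scope classical_set_scope.
Local Open Scope ring_scope.

(* Functions on (0, +oo) are represented by total functions R -> R; when
   0 < q, no definition below looks at a value outside (0, +oo). *)

Definition qpochhammer (R : realType) (a q : R) (n : nat) : R :=
  \prod_(0 <= s < n) (1 - a * q ^+ s).

(* [is_qint q x f l]: the Jackson integral of f over (0, x] converges, to l. *)
Definition is_qint (R : realType) (q x : R) (f : R -> R) (l : R) : Prop :=
  exists s : R,
    series (fun j : nat => f (x * q ^+ j) * q ^+ j) @ \oo --> s /\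
    l = x * (1 - q) * s.

(* [is_qint_infty q f l]: the Jackson integral of f over (0, +oo) converges,
   to l. The bilateral series converges when both its half (j >= 0) and its
   half (j < 0, indexed by j = - n.+1) converge. *)
Definition is_qint_infty (R : realType) (q : R) (f : R -> R) (l : R) : Prop :=
  exists s t : R,
    [/\ series (fun j : nat => f (q ^+ j) * q ^+ j) @ \oo --> s,
        series (fun n : nat => f (q ^- n.+1) * q ^- n.+1) @ \oo --> t
      & l = (1 - q) * (s + t)].

Definition is_qdensity_of (R : realType) (q : R) (f : R -> R)
    (d : measure_display) (T : measurableType d) (P : probability T R)
    (X : {RV P >-> R}) : Prop :=
  forall x : R, 0 < x -> exists2 l : R, is_qint q x f l & cdf X x = l%:E.

Definition is_qdensity (R : realType) (q : R) (f : R -> R) : Prop :=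
  exists (d : measure_display) (T : measurableType d) (P : probability T R)
    (X : {RV P >-> R}), is_qdensity_of q f X.

(* m is the k-th order q-moment of a random variable with q-density f. *)
Definition is_qmoment (R : realType) (q : R) (f : R -> R) (k : nat) (m : R) :
  Prop := is_qint_infty q (fun t => t ^+ k * f t) m.

Definition qequiv (R : realType) (q : R) (f g : R -> R) : Prop :=
  forall j : int, f (q ^ j) = g (q ^ j).

(* [sup] is 0 on sets that are not bounded above, so in [is_qperturbation] the
   equation with 1 also says that h is bounded on the powers of q. *)
Definition qsup (R : realType) (q : R) (h : R -> R) : R :=
  sup [set `|h (q ^ j)| | j in [set: int]].

Definition is_qperturbation (R : realType) (q : R) (f h : R -> R) : Prop :=
  qsup q h = 1 /\
  forall k : nat, is_qint_infty q (fun t => t ^+ k * f t * h t) 0.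

(* S is the q-Stieltjes class for f generated by h. *)
Definition is_qStieltjes_class (R : realType) (q : R) (f h : R -> R)
    (S : set (R -> R)) : Prop :=
  [/\ is_qdensity q f, is_qperturbation q f h
    & S = [set g | is_qdensity q g /\
             exists2 eps : R, -1 <= eps <= 1 &
               qequiv q g (fun t => (1 + eps * h t) * f t)]].

(* Main.v *)
(* On the powers q^-j the weight f(t) h(t) t^k t is, up to the factor 1/M, the
   j-th term of Euler's expansion
     (z; q)_oo = sum_j (-1)^j q^(j(j-1)/2) z^j / (q; q)_j   at z = q^-k,
   and (q^-k; q)_oo = 0. The vanishing is obtained without infinite products:
   at z = 1 the partial sums telescope, and the functional equation
   E(z) = (1 - z) E(q z), in a form valid for partial sums, gives the other
   z = q^-k by induction on k. The bound on f and the positivity of (q; q)_oo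
   make the perturbation bounded. *)
Require Import Defs.
From mathcomp Require Import all_boot all_order all_algebra.
From mathcomp Require Import all_classical all_reals all_analysis.
From mathcomp Require Import ring lra.

Import Order.TTheory GRing.Theory Num.Theory.
Import numFieldTopology.Exports numFieldNormedType.Exports.

Local Open Scope classical_set_scope.
Local Open Scope ring_scope.

Lemma qpochhammerS (R : realType) (a q : R) (n : nat) :
  qpochhammer a q n.+1 = qpochhammer a q n * (1 - a * q ^+ n).
Proof. by rewrite /qpochhammer big_nat_recr. Qed.

(* The exponential g n satisfies g (n + 1) <= g n * (1 - q ^ (n + 1)), because
   expR (- y) <= (1 + y)^-1. *)
Lemma qpochhammer_ge_expR (R : realType) (q : R) (n : nat) : 0 < q < 1 ->
  expR (q / (1 - q) ^+ 2 * (q ^+ n - 1)) <= qpochhammer q q n.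
Proof.
move=> /andP[q0 q1]; set K := q / _.
have r0 : 0 < 1 - q by rewrite subr_gt0.
elim: n => [|n IHn].
  by rewrite expr0 subrr mulr0 expR0 /qpochhammer big_geq.
have qn0 : 0 < q ^+ n by rewrite exprn_gt0.
have qn1 : q ^+ n <= 1 by rewrite exprn_ile1 ?ltW.
(* [K] is chosen so that y (1 - q) = q^(n+1); since q^(n+1) <= q, this yields (1 + y) (1 - q^(n+1))
   >= 1. *)
set y := K * q ^+ n * (1 - q).
have y0 : 0 < y by rewrite !mulr_gt0 // invr_gt0 exprn_gt0.
have -> : K * (q ^+ n.+1 - 1) = K * (q ^+ n - 1) - y by rewrite /y exprS; ring.
have step : expR (- y) <= 1 - q * q ^+ n.
  rewrite expRN; apply: (@le_trans _ _ (1 + y)^-1).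
    by rewrite lef_pV2 ?posrE ?expR_gt0 ?expR_ge1Dx // addr_gt0.
  rewrite -[leLHS]mul1r ler_pdivrMr ?addr_gt0 //.
  have yE : y * (1 - q) = q * q ^+ n.
    by rewrite /y /K; field; rewrite gt_eqF.
  have : y * (q * q ^+ n) <= y * q by rewrite ler_pM2l // ger_pMr.
  by nra.
by rewrite expRD qpochhammerS ler_pM ?expR_ge0.
Qed.

(** The exponents in the previous bound stay above their limit, which gives a constant uniform in n;
    this stands in for (q; q)_oo > 0. *)
Lemma qpochhammer_bounded_below (R : realType) (q : R) : 0 < q < 1 ->
  exists2 c : R, 0 < c & forall n, c <= qpochhammer q q n.
Proof.
move=> hq; exists (expR (- (q / (1 - q) ^+ 2))); first exact: expR_gt0.
move=> n; apply: le_trans (qpochhammer_ge_expR _ _ n hq).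
have /andP[q0 q1] := hq.
rewrite ler_expR mulrBr mulr1 lerDr mulr_ge0 ?exprn_ge0 ?divr_ge0 ?ltW //.
by rewrite exprn_gt0 // subr_gt0.
Qed.

Lemma qpochhammer_gt0 (R : realType) (q : R) (n : nat) : 0 < q < 1 ->
  0 < qpochhammer q q n.
Proof.
by move=> /qpochhammer_bounded_below[c c0 cle]; apply: lt_le_trans (cle n).
Qed.

Definition euler_term {R : realType} (q z : R) (j : nat) : R :=
  (-1) ^+ j * (q ^+ 'C(j, 2) * z ^+ j / qpochhammer q q j).

(** The difference z^(n+1) - (q z)^(n+1) has the factor 1 - q^(n+1), which cancels the last factor
    of (q; q)_(n+1). This is E(z) = (1 - z) E(q z) read off degree by degree. *)
Lemma euler_term_shift (R : realType) (q z : R) (n : nat) : 0 < q < 1 ->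
  euler_term q z n.+1 = euler_term q (q * z) n.+1 - z * euler_term q (q * z) n.
Proof.
move=> hq; have := qpochhammer_gt0 _ _ n.+1 hq; have := qpochhammer_gt0 _ _ n hq.
rewrite /euler_term qpochhammerS => p0 /gt_eqF/negbT.
rewrite mulf_eq0 negb_or => /andP[_ r0].
rewrite binS bin1 !exprMn exprD !exprS; field.
by rewrite r0 gt_eqF.
Qed.

(** The factor z raises the degree by one, so the sum that it multiplies stops one term earlier. *)
Lemma series_euler_term_shift (R : realType) (q z : R) (n : nat) : 0 < q < 1 ->
  series (euler_term q z) n.+1 =
    series (euler_term q (q * z)) n.+1 - z * series (euler_term q (q * z)) n.
Proof.
move=> hq; elim: n => [|n IHn].
  by rewrite !seriesEnat /= !big_nat1 big_geq // mulr0 subr0 /euler_term !expr0.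
rewrite seriesSr IHn euler_term_shift // !seriesSr; ring.
Qed.

(** Adding the term of index n + 1 multiplies the partial sum by 1 - 1 / (1 - q^(n+1)) = - q^(n+1) /
    (1 - q^(n+1)). *)
Lemma series_euler_term1 (R : realType) (q : R) (n : nat) : 0 < q < 1 ->
  series (euler_term q 1) n.+1 =
    (-1) ^+ n * (q ^+ 'C(n.+1, 2) / qpochhammer q q n).
Proof.
move=> hq; elim: n => [|n IHn].
  by rewrite seriesEnat /= big_nat1 /euler_term !expr0 mulr1.
have := qpochhammer_gt0 _ _ n.+1 hq; have := qpochhammer_gt0 _ _ n hq.
rewrite seriesSr IHn /euler_term qpochhammerS => p0 /gt_eqF/negbT.
rewrite mulf_eq0 negb_or => /andP[_ r0].
rewrite (binS n.+1) bin1 expr1n exprD !exprS; field.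
by rewrite r0 gt_eqF.
Qed.

Lemma cvg_series_euler_term (R : realType) (q : R) (k : nat) : 0 < q < 1 ->
  series (euler_term q (q ^- k)) @ \oo --> (0 : R).
Proof.
move=> hq; have /andP[q0 q1] := hq.
elim: k => [|k IHk].
  rewrite expr0 invr1 -cvg_shiftS /=.
  have [c c0 cle] := qpochhammer_bounded_below _ _ hq.
  have qcvg : GRing.exp q @ \oo --> (0 : R).
    by apply: cvg_expr; rewrite ger0_norm ?ltW.
  apply/cvgr0Pnorm_le => e e0; near=> n.
  rewrite series_euler_term1 // normrM normrX normrN1 expr1n mul1r.
  rewrite ger0_norm; last by rewrite divr_ge0 ?exprn_ge0 ?ltW ?qpochhammer_gt0.
  rewrite ler_pdivrMr ?qpochhammer_gt0 //.
  apply: (@le_trans _ _ (e * c)); last by rewrite ler_pM2l.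
  (* The crude bound q^(n(n+1)/2) <= q^n is enough here. *)
  rewrite binS bin1 exprD; apply: (@le_trans _ _ (q ^+ n)).
    by rewrite ger_pMl ?exprn_gt0 // exprn_ile1 ?ltW.
  rewrite -[leLHS]ger0_norm ?exprn_ge0 ?(ltW q0) //; near: n.
  by apply: (cvgr0_norm_le _ qcvg); rewrite mulr_gt0.
rewrite -cvg_shiftS /=.
(* The shift leads back to q^-k, where both partial sums tend to 0 by induction. *)
have qE : q * q ^- k.+1 = q ^- k by rewrite exprS invfM mulVKf ?gt_eqF.
under eq_fun do rewrite series_euler_term_shift // qE.
have cvgS : series (euler_term q (q ^- k)) n.+1 @[n --> \oo] --> (0 : R).
  by rewrite (cvg_shiftS (series _)).
have := cvgB cvgS (cvgMl_tmp (a := q ^- k.+1) IHk).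
by rewrite mulr0 subr0; apply.
Unshelve. all: by end_near. Qed.

Lemma qsup_div (R : realType) (q : R) (u : R -> R) :
  has_ubound [set `|u (q ^ j)| | j in [set: int]] -> 0 < qsup q u ->
  qsup q (fun t => u t / qsup q u) = 1.
Proof.
move=> ubu; set M := qsup q u => M0.
have leM j : `|u (q ^ j)| <= M by apply: ub_le_sup => //; exists j.
have normE j : `|u (q ^ j) / M| = `|u (q ^ j)| / M.
  by rewrite normrM (ger0_norm (x := M^-1)) // invr_ge0 ltW.
have ub1 : ubound [set `|u (q ^ j) / M| | j in [set: int]] 1.
  by move=> _ [j _ <-]; rewrite normE ler_pdivrMr // mul1r.
apply/eqP; rewrite eq_le; apply/andP; split.
  by apply: ge_sup => //; exists `|u (q ^ 0) / M|; exists 0.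
rewrite -(ler_pM2r M0) mul1r.
apply: ge_sup; first by exists `|u (q ^ 0)|; exists 0.
move=> _ [j _ <-]; rewrite -ler_pdivrMr // -normE.
by apply: ub_le_sup; [exists 1 | exists j].
Qed.

Theorem corollary2p3 (R : realType) (q : R) (hq : 0 < q < 1)
    (d : measure_display) (T : measurableType d) (P : probability T R)
    (X : {RV P >-> R}) (f : R -> R)
    (hf : is_qdensity_of q f X)
    (hmom : forall k : nat, exists m : R, is_qmoment q f k m)
    (C : R) (hC : 0 < C)
    (hfC : forall j : nat, C * q ^+ ((j * j.+1) %/ 2) <= f (q ^- j))
    (ht : R -> R)
    (ht_nonneg : forall j : nat,
      ht (q ^- j) =
        (-1) ^+ j * (q ^+ ((j * j.+1) %/ 2) / (qpochhammer q q j * f (q ^- j))))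
    (ht_neg : forall j : nat, ht (q ^+ j.+1) = 0) :
  let h : R -> R := fun t => ht t / qsup q ht in
  let S : set (R -> R) :=
    [set g | is_qdensity q g /\
       exists2 eps : R, -1 <= eps <= 1 &
         qequiv q g (fun t => (1 + eps * h t) * f t)] in
  is_qperturbation q f h /\ is_qStieltjes_class q f h S.
Proof.
have /andP[q0 q1] := hq.
move=> h S; suff : is_qperturbation q f h.
  by move=> hpert; split=> //; split=> //; exists d, T, P, X.
move: @h {S} => h.
have triE j : (j * j.+1 %/ 2)%N = 'C(j.+1, 2) by rewrite bin2 divn2 mulnC.
have f_gt0 j : 0 < f (q ^- j).
  by apply: lt_le_trans (hfC j); rewrite mulr_gt0 ?exprn_gt0.
have [c c0 cle] := qpochhammer_bounded_below _ _ hq.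
have ubht : has_ubound [set `|ht (q ^ j)| | j in [set: int]].
  (* The lower bound on f absorbs the numerator q^(j(j+1)/2), and [c] bounds (q; q)_j. *)
  have ht_le j : `|ht (q ^- j)| <= (c * C)^-1.
    rewrite ht_nonneg normrM normrX normrN1 expr1n mul1r ger0_norm; last first.
      by rewrite divr_ge0 ?mulr_ge0 ?exprn_ge0 // ltW // qpochhammer_gt0.
    rewrite ler_pdivrMr ?mulr_gt0 ?qpochhammer_gt0 //.
    rewrite mulrC ler_pdivlMr ?mulr_gt0 // mulrCA.
    apply: ler_pM; [exact: ltW | | exact: cle | by rewrite mulrC].
    by rewrite mulr_ge0 ?exprn_ge0 ?ltW.
  exists (c * C)^-1 => _ [[[|j]|j] _ <-].
  - by rewrite -[q ^ _]invr1 -[1](expr0 q); apply: ht_le.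
  - by rewrite ht_neg normr0 invr_ge0 mulr_ge0 ?ltW.
  - exact: ht_le.
have M0 : 0 < qsup q ht.
  apply: (@lt_le_trans _ _ `|ht (q ^ 0)|); last first.
    by apply: ub_le_sup => //; exists 0.
  (* The value at t = 1 is the case j = 0 of [ht_nonneg], that is 1 / f(1). *)
  rewrite normr_gt0 -[q ^ 0]invr1 -[1](expr0 q) ht_nonneg mulf_neq0 //.
    by rewrite expr0 oner_neq0.
  by rewrite gt_eqF // divr_gt0 ?mulr_gt0 ?exprn_gt0 ?qpochhammer_gt0.
split=> [|k]; first exact: qsup_div.
set M := qsup q ht in h M0 *.
pose F (t : R) := t ^+ k * f t * h t.
(* The density cancels, and the weight q^-j turns q^(j(j+1)/2) into q^(j(j-1)/2). *)
have FE j : F (q ^- j) * q ^- j = M^-1 * euler_term q (q ^- k) j.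
  rewrite /F /h ht_nonneg /euler_term triE binS bin1 exprD !exprVn -!exprM.
  rewrite (mulnC k j); field.
  by rewrite !expf_neq0 ?gt_eqF // ?qpochhammer_gt0.
(* On the powers q^j with j >= 0 only t = 1 contributes. The other half is the Euler series, of sum
   0, without its term of index 0, which is [F 1]. *)
exists (F 1), (- F 1); split; last by rewrite subrr mulr0.
- rewrite -cvg_shiftS /=; apply: cvg_near_cst; apply: nearW => n.
  rewrite seriesEnat /= big_nat_recl //= big1 => [|i _].
    by rewrite expr0 mulr1 addr0.
  by rewrite /h ht_neg mul0r mulr0 mul0r.
- have F1E : F 1 = M^-1 * euler_term q (q ^- k) 0.
    by rewrite -FE expr0 invr1 mulr1.
  have -> : series (fun n => F (q ^- n.+1) * q ^- n.+1) =
      (fun n => M^-1 * series (euler_term q (q ^- k)) n.+1 - F 1).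
    apply/funext => n; rewrite !seriesEnat /= big_nat_recl // mulrDr F1E.
    rewrite addrAC subrr add0r mulr_sumr.
    by apply: eq_bigr => i _; rewrite FE.
  have cvgS : series (euler_term q (q ^- k)) n.+1 @[n --> \oo] --> (0 : R).
    by rewrite (cvg_shiftS (series _)); apply: cvg_series_euler_term.
  have := cvgB (cvgMl_tmp (a := M^-1) cvgS) (cvg_cst (F 1)).
  by rewrite mulr0 sub0r; apply.
Qed.
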